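(* Let $\Lambda$ be a row-finite, locally-convex $k$-graph satisfying Condition (B), and $R$ a commutative ring with $1$. If $J$ is a regular, basic, graded ideal of $KP_R(\Lambda)$, then the $k$-graph $\Lambda\setminus H(J)$ satisfies Condition (B).
   Context: A $k$-graph $(\Lambda,d)$ is a countable category with a functor $d:\Lambda\to\mathbb{N}^k$ with unique factorization; vertices $\Lambda^0$ are degree-$0$ paths, $r,s$ range and source, $\mathbb{N}^k$ ordered coordinatewise, $e_i$ standard generators. Row-finite: finitely many paths of each degree with each range. $\Lambda^{\le n}=\{\lambda:d(\lambda)\le n,\ d(\lambda)_i<n_i\Rightarrow s(\lambda)\Lambda^{e_i}=\emptyset\}$. Locally-convex: for $i\ne j$, $\lambda\in v\Lambda^{e_i}$, $\mu\in v\Lambda^{e_j}$, $s(\lambda)\Lambda^{e_j}\ne\emptyset\ne s(\mu)\Lambda^{e_i}$. For $H\subseteq\Lambda^0$, $\Lambda\setminus H$ is the subcategory with objects $\Lambda^0\setminus H$, morphisms $\{\lambda:r(\lambda),s(\lambda)\notin H\}$, restricted degree. Boundary paths and Condition (B): for $m\in(\mathbb{N}\cup\{\infty\})^k$, $\Omega_{k,m}$ is the $k$-graph with objects $\{p\in\mathbb{N}^k:p\le m\}$, morphisms $(p,q)$, $p\le q\le m$, $r(p,q)=p$, $s(p,q)=q$, $(p,q)(q,t)=(p,t)$, $d(p,q)=q-p$. A boundary path is a degree-preserving functor $x:\Omega_{k,m}\to\Lambda$ such that if an object $p$ of $\Omega_{k,m}$ has $p\,\Omega_{k,m}^{\le e_i}=\{p\}$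 then $x(p)\Lambda^{\le e_i}=\{x(p)\}$; $r(x)=x(0)$; $v\Lambda^{\le\infty}$ denotes boundary paths with range $v$; for $s(\lambda)=r(x)$, $\lambda x$ is the concatenated boundary path. A vertex $v$ satisfies Condition (B) if some $x\in v\Lambda^{\le\infty}$ has $\alpha x\ne\beta x$ whenever $\alpha\ne\beta$ in $\Lambda$ (with $s(\alpha)=s(\beta)=v$); a $k$-graph satisfies Condition (B) if all its vertices do. $KP_R(\Lambda)$ is the universal $R$-algebra generated by $p_v$, $s_\lambda,s_{\lambda^*}$ with relations (KP1) $p_v$ mutually orthogonal idempotents; (KP2) $s_\lambda s_\mu=s_{\lambda\mu}$, $s_{\mu^*}s_{\lambda^*}=s_{(\lambda\mu)^*}$, $p_{r(\lambda)}s_\lambda=s_\lambda=s_\lambda p_{s(\lambda)}$, $p_{s(\lambda)}s_{\lambda^*}=s_{\lambda^*}=s_{\lambda^*}p_{r(\lambda)}$; (KP3) $s_{\lambda^*}s_\mu=\delta_{\lambda,\mu}p_{s(\lambda)}$ for $\lambda,\mu\in\Lambda^{\le n}$, $n\ne0$; (KP4) $p_v=\sum_{\lambda\in v\Lambda^{\le n}}s_\lambda s_{\lambda^*}$, $n\ne0$. It is $\mathbb{Z}^k$-graded by $KP_R(\Lambda)_n=\mathrm{span}\{s_\alpha s_{\beta^*}:d(\alpha)-d(\beta)=n\}$; graded ideals contain the homogeneous components of their elements; an ideal is basic if $rp_v\in I$, $r\ne0$ imply $p_v\in I$. $H(I)=\{v:p_v\in I\}$. $I^\perp=\{a:ax=xa=0\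 \forall x\in I\}$; $I$ regular if $I^{\perp\perp}=I$. *)

(* Defs.v *)
From HB Require Import structures.
From mathcomp Require Import all_boot all_order all_algebra.
Set Implicit Arguments. Unset Strict Implicit. Unset Printing Implicit Defensive.
Import GRing.Theory.

Definition ndeg (k : nat) := {ffun 'I_k -> nat}.
Definition zdeg (k : nat) := {ffun 'I_k -> int}.
(* (N u {oo})^k ; None = infinity *)
Definition edeg (k : nat) := {ffun 'I_k -> option nat}.

Section Degrees.
Variable k : nat.
Definition dzero : ndeg k := [ffun => 0%N].
Definition dadd (m n : ndeg k) : ndeg k := [ffun i => (m i + n i)%N].
Definition dsub (m n : ndeg k) : ndeg k := [ffun i => (m i - n i)%N].
Definition dle (m n : ndeg k) : Prop := forall i, (m i <= n i)%N.
Definition unit_deg (i : 'I_k) : ndeg k := [ffun j => nat_of_bool (j == i)].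
Definition dzsub (m n : ndeg k) : zdeg k := [ffun i => ((m i)%:Z - (n i)%:Z)%R].
Definition ext_le (q : ndeg k) (m : edeg k) : Prop :=
  forall i, if m i is Some mi then (q i <= mi)%N else true.
Definition ext_add (n : ndeg k) (m : edeg k) : edeg k :=
  [ffun i => omap (addn (n i)) (m i)].
End Degrees.

(* A countable category (objects kvert, morphisms kpath, both countable),
   with composition kcomp (meaningful on composable pairs, ks a = kr b),
   identities kid, and a degree functor kd with unique factorisation. *)
Record kgraph (k : nat) := KGraph {
  kvert : countType;
  kpath : countType;
  kr : kpath -> kvert;
  ks : kpath -> kvert;
  kd : kpath -> ndeg k;
  kcomp : kpath -> kpath -> kpath;
  kid : kvert -> kpath;
  kid_rng : forall v, kr (kid v) = v;
  kid_src : forall v, ks (kid v) = v;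
  kid_deg : forall v, kd (kid v) = dzero k;
  kcomp_rng : forall a b, ks a = kr b -> kr (kcomp a b) = kr a;
  kcomp_src : forall a b, ks a = kr b -> ks (kcomp a b) = ks b;
  kcomp_deg : forall a b, ks a = kr b -> kd (kcomp a b) = dadd (kd a) (kd b);
  kcomp_idl : forall a, kcomp (kid (kr a)) a = a;
  kcomp_idr : forall a, kcomp a (kid (ks a)) = a;
  kcomp_assoc : forall a b c, ks a = kr b -> ks b = kr c ->
      kcomp (kcomp a b) c = kcomp a (kcomp b c);
  kfactor : forall l (m n : ndeg k), kd l = dadd m n ->
      exists! mn : kpath * kpath,
        [/\ kd mn.1 = m, kd mn.2 = n, ks mn.1 = kr mn.2 & l = kcomp mn.1 mn.2]
}.

Section KGraphNotions.
Variables (k : nat) (L : kgraph k).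
Local Notation V := (kvert L).
Local Notation P := (kpath L).

Definition row_finite : Prop :=
  forall (v : V) (n : ndeg k), exists S : seq P,
    forall l, kr l = v -> kd l = n -> l \in S.

(* Everything below is relative to a predicate A of allowed vertices:
   A = (fun _ => True) gives Lambda itself, A = (fun v => ~ H v) gives the
   subcategory Lambda \ H (objects Lambda^0 \ H, morphisms with range and
   source outside H, restricted degree). *)
Definition subpath (A : V -> Prop) (l : P) : Prop := A (kr l) /\ A (ks l).

Definition le_set (A : V -> Prop) (n : ndeg k) (l : P) : Prop :=
  [/\ subpath A l, dle (kd l) n &
      forall i, (kd l i < n i)%N ->
        ~ exists mu, [/\ subpath A mu, kr mu = ks l & kd mu = unit_deg i]].

Definition locally_convex : Prop :=
  forall (i j : 'I_k) (l mu : P), i != j -> kr l = kr mu ->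
    kd l = unit_deg i -> kd mu = unit_deg j ->
    (exists a, kr a = ks l /\ kd a = unit_deg j) /\
    (exists b, kr b = ks mu /\ kd b = unit_deg i).

(* x : Omega_{k,m} -> Lambda given on morphisms (p,q), p <= q <= m;
   degree-preserving functor. The object p is sent to kr (x p p). *)
Definition is_functor (m : edeg k) (x : ndeg k -> ndeg k -> P) : Prop :=
  [/\ (forall p q, dle p q -> ext_le q m -> kd (x p q) = dsub q p),
      (forall p q t, dle p q -> dle q t -> ext_le t m ->
          ks (x p q) = kr (x q t) /\ kcomp (x p q) (x q t) = x p t) &
      (forall p, ext_le p m -> x p p = kid (kr (x p p)))].

Definition omega_le_only (m : edeg k) (p n : ndeg k) : Prop :=
  forall q : ndeg k,
    [/\ dle p q, ext_le q m, dle (dsub q p) n &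
        forall j, (dsub q p j < n j)%N -> ~ ext_le (dadd q (unit_deg j)) m]
    <-> q = p.

Definition boundary_path (A : V -> Prop) (m : edeg k)
    (x : ndeg k -> ndeg k -> P) : Prop :=
  [/\ is_functor m x,
      (forall p q, dle p q -> ext_le q m -> subpath A (x p q)) &
      (forall p (i : 'I_k), ext_le p m -> omega_le_only m p (unit_deg i) ->
         forall l, (le_set A (unit_deg i) l /\ kr l = kr (x p p))
                   <-> l = kid (kr (x p p)))].

Definition concat_is (l : P) (m : edeg k) (x : ndeg k -> ndeg k -> P)
    (m' : edeg k) (y : ndeg k -> ndeg k -> P) : Prop :=
  [/\ m' = ext_add (kd l) m, is_functor m' y &
      forall q, ext_le q m -> y (dzero k) (dadd (kd l) q) = kcomp l (x (dzero k) q)].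

Definition concat_eq (a b : P) (m : edeg k) (x : ndeg k -> ndeg k -> P) : Prop :=
  exists m' y, concat_is a m x m' y /\ concat_is b m x m' y.

Definition condB_at (A : V -> Prop) (v : V) : Prop :=
  exists m x, [/\ boundary_path A m x, kr (x (dzero k) (dzero k)) = v &
    forall a b, subpath A a -> subpath A b -> ks a = v -> ks b = v ->
      a <> b -> ~ concat_eq a b m x].

Definition condB (A : V -> Prop) : Prop := forall v, A v -> condB_at A v.

Variables (R : comRingType) (Alg : algType R).
Variables (p : V -> Alg) (s ss : P -> Alg).
Local Open Scope ring_scope.

Definition KP_family (B : algType R) (q : V -> B) (t tt : P -> B) : Prop :=
  [/\ (forall v, q v * q v = q v) /\ (forall v w, v <> w -> q v * q w = 0),
      (forall a b, ks a = kr b -> t a * t b = t (kcomp a b) /\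
                                  tt b * tt a = tt (kcomp a b)) /\
      (forall a, [/\ q (kr a) * t a = t a, t a * q (ks a) = t a,
                     q (ks a) * tt a = tt a & tt a * q (kr a) = tt a]),
      (forall (n : ndeg k) a b, n <> dzero k ->
          le_set (fun _ => True) n a -> le_set (fun _ => True) n b ->
          tt a * t b = if a == b then q (ks a) else 0) &
      (forall v (n : ndeg k), n <> dzero k -> forall S : seq P, uniq S ->
          (forall a, a \in S <-> (le_set (fun _ => True) n a /\ kr a = v)) ->
          q v = \sum_(a <- S) t a * tt a)].

Inductive KPgen : Alg -> Prop :=
| KPgen_p v : KPgen (p v)
| KPgen_s a : KPgen (s a)
| KPgen_ss a : KPgen (ss a)
| KPgen_add x y : KPgen x -> KPgen y -> KPgen (x + y)
| KPgen_scale (c : R) x : KPgen x -> KPgen (c *: x)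
| KPgen_mul x y : KPgen x -> KPgen y -> KPgen (x * y).

Definition KP_universal : Prop :=
  forall (B : algType R) (q : V -> B) (t tt : P -> B), KP_family q t tt ->
    exists phi : Alg -> B,
      [/\ forall x y, KPgen x -> KPgen y ->
            phi (x + y) = phi x + phi y /\ phi (x * y) = phi x * phi y,
          forall (c : R) x, KPgen x -> phi (c *: x) = c *: phi x,
          forall v, phi (p v) = q v &
          forall a, phi (s a) = t a /\ phi (ss a) = tt a].

Definition KP_ideal (J : Alg -> Prop) : Prop :=
  [/\ forall x, J x -> KPgen x,
      J 0,
      forall x y, J x -> J y -> J (x + y),
      forall x, J x -> J (- x) &
      forall x y, KPgen x -> J y -> J (x * y) /\ J (y * x)].

Definition homogeneous (n : zdeg k) (x : Alg) : Prop :=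
  exists S : seq (R * P * P),
    (forall z, z \in S -> dzsub (kd z.1.2) (kd z.2) = n) /\
    x = \sum_(z <- S) z.1.1 *: (s z.1.2 * ss z.2).

Definition graded_ideal (J : Alg -> Prop) : Prop :=
  forall x, J x -> forall S : seq (zdeg k * Alg), uniq (map fst S) ->
    (forall z, z \in S -> homogeneous z.1 z.2) ->
    x = \sum_(z <- S) z.2 -> forall z, z \in S -> J z.2.

Definition basic_ideal (J : Alg -> Prop) : Prop :=
  forall (c : R) v, c != 0 -> J (c *: p v) -> J (p v).

Definition HJ (J : Alg -> Prop) : V -> Prop := fun v => J (p v).

Definition perp (I : Alg -> Prop) : Alg -> Prop :=
  fun x => KPgen x /\ forall y, I y -> x * y = 0 /\ y * x = 0.

Definition regular_ideal (J : Alg -> Prop) : Prop :=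
  forall x, J x <-> perp (perp J) x.

End KGraphNotions.

(* Main.v *)
Require Import Defs.
From HB Require Import structures.
From mathcomp Require Import all_boot all_order all_algebra.
From mathcomp Require Import zify boolp classical_sets.
Set Implicit Arguments. Unset Strict Implicit. Unset Printing Implicit Defensive.
Import GRing.Theory.

(* The annihilator of an ideal J sees the vertices that cannot reach H = H(J). If every
   path from w can be continued into H and x annihilates J, then each x s_b with
   r(b) = w and b long enough is a combination of shifts s_a with source s(b), and
   killing it by s_c, c a path from s(b) into H, gives a relation among shifts with a
   common source. An aperiodic boundary path at that source separates these shifts in
   the boundary path representation, so x s_b = 0 and hence x p_w = 0; likewise
   p_w x = 0. Thus p_w lies in the double annihilator of J, which is J. Consequently a vertex
   w outside H admits a path l whose source never reaches H, and prolonging an aperiodic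
   boundary path at s(l) by l gives one at w that avoids H. *)

(** * Paths and boundary filters *)

Lemma ndegP (k : nat) (q t : ndeg k) : q = t <-> forall i, q i = t i.
Proof. by split=> [->//|h]; apply/ffunP. Qed.

Ltac degree_ext := apply/ndegP => ?; rewrite !ffunE; lia.

Section Paths.
Variables (k : nat) (L : kgraph k).
Local Notation V := (kvert L).
Local Notation P := (kpath L).
Implicit Types (a b c l m : P) (v : V) (n q t : ndeg k) (i j : 'I_k).

Definition dmax q t : ndeg k := [ffun i => maxn (q i) (t i)].
Definition dmin q t : ndeg k := [ffun i => minn (q i) (t i)].

Lemma dle_trans q n t : dle q n -> dle n t -> dle q t.
Proof. by move=> h1 h2 i; apply: leq_trans (h1 i) (h2 i). Qed.

Lemma dle_maxl q t : dle q (dmax q t).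
Proof. by move=> i; rewrite ffunE leq_maxl. Qed.

Lemma dle_maxr q t : dle t (dmax q t).
Proof. by move=> i; rewrite ffunE leq_maxr. Qed.

Lemma dsubK q n : dle q n -> dadd q (dsub n q) = n.
Proof. by move=> h; apply/ndegP => i; rewrite !ffunE subnKC. Qed.

Lemma dadd_subl q n : dsub (dadd q n) q = n.
Proof. by degree_ext. Qed.

Lemma dle_add q n : dle q (dadd q n).
Proof. by move=> i; rewrite ffunE leq_addr. Qed.

Lemma dle_comp a b : ks a = kr b -> dle (kd a) (kd (kcomp a b)).
Proof. by move=> e; rewrite kcomp_deg //; apply: dle_add. Qed.

(** Equal first degrees force equal second degrees, so both pairs are the one factorisation allowed
    by [kfactor]. *)
Lemma kcomp_inj a b c l : ks a = kr b -> ks c = kr l -> kd a = kd c ->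
  kcomp a b = kcomp c l -> a = c /\ b = l.
Proof.
move=> ab cl dac e.
have dbl : kd b = kd l.
  have := congr1 (@kd _ L) e; rewrite !kcomp_deg // dac => h.
  by rewrite -[kd b](dadd_subl (kd c)) h dadd_subl.
have [mn [_ u]] := kfactor (kcomp_deg ab).
have h1 : (a, b) = mn by symmetry; apply: u; split.
have h2 : (c, l) = mn by symmetry; apply: u; split.
by move: h1; rewrite -h2 => -[-> ->].
Qed.

Lemma kcomp_injl a b c : ks a = kr b -> ks a = kr c ->
  kcomp a b = kcomp a c -> b = c.
Proof. by move=> h1 h2 e; have [] := kcomp_inj h1 h2 erefl e. Qed.

Lemma kcomp_injr a b c : ks a = kr c -> ks b = kr c ->
  kcomp a c = kcomp b c -> a = b.
Proof.
move=> h1 h2 e; have d : kd a = kd b.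
  have := congr1 (@kd _ L) e; rewrite !kcomp_deg // => /ndegP h.
  by apply/ndegP => i; have := h i; rewrite !ffunE; lia.
by have [] := kcomp_inj h1 h2 d e.
Qed.

(** An identity placed before or after [l] gives two factorisations of [l] with the same degrees, so
    their first factors agree. *)
Lemma kd0_id l : kd l = dzero k -> l = kid (kr l).
Proof.
move=> d; have s : ks l = kr (kid (ks l)) by rewrite kid_rng.
have s' : ks (kid (kr l)) = kr l by rewrite kid_src.
have dl : kd l = kd (kid (kr l)) by rewrite kid_deg.
have e : kcomp l (kid (ks l)) = kcomp (kid (kr l)) l.
  by rewrite kcomp_idr kcomp_idl.
by have [] := kcomp_inj s s' dl e.
Qed.

(** [xget] selects the factorisation supplied by [kfactor]; the default [(l, l)] is returned only
    when [q] is not below [kd l]. *)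
Definition split_at l q : P * P :=
  xget (l, l) [set mn | [/\ kd mn.1 = q, ks mn.1 = kr mn.2 &
                          l = kcomp mn.1 mn.2]].
Definition prefix_at l q := (split_at l q).1.
Definition suffix_at l q := (split_at l q).2.

Lemma split_atP l q : dle q (kd l) ->
  [/\ kd (prefix_at l q) = q, ks (prefix_at l q) = kr (suffix_at l q) &
      l = kcomp (prefix_at l q) (suffix_at l q)].
Proof.
move=> h; rewrite /prefix_at /suffix_at /split_at.
case: xgetP => [mn _ //|] none.
have [mn [[h1 _ h2 h3] _]] := kfactor (esym (dsubK h)).
by case: (none mn).
Qed.

Lemma split_at_comp a b : ks a = kr b ->
  prefix_at (kcomp a b) (kd a) = a /\ suffix_at (kcomp a b) (kd a) = b.
Proof.
move=> ab; have [h1 h2 h3] := split_atP (dle_comp ab).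
by have [-> ->] := kcomp_inj h2 ab h1 (esym h3).
Qed.

Lemma suffix_at_deg l q : dle q (kd l) -> kd (suffix_at l q) = dsub (kd l) q.
Proof.
move=> h; have [h1 h2 h3] := split_atP h.
by rewrite {2}h3 kcomp_deg // h1 dadd_subl.
Qed.

Definition is_prefix a l := exists2 b, ks a = kr b & l = kcomp a b.

Lemma is_prefix_refl a : is_prefix a a.
Proof. by exists (kid (ks a)); rewrite ?kid_rng ?kcomp_idr. Qed.

Lemma is_prefix_trans a b c : is_prefix a b -> is_prefix b c -> is_prefix a c.
Proof.
move=> [x ax ->] [y bY ->]; rewrite kcomp_src // in bY.
by exists (kcomp x y); rewrite ?kcomp_rng ?kcomp_assoc.
Qed.

Lemma is_prefix_rng a l : is_prefix a l -> kr l = kr a.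
Proof. by move=> [b ab ->]; rewrite kcomp_rng. Qed.

Lemma is_prefix_deg a l : is_prefix a l -> dle (kd a) (kd l).
Proof. by move=> [b ab ->]; apply: dle_comp. Qed.

Lemma prefix_at_prefix l q : dle q (kd l) -> is_prefix (prefix_at l q) l.
Proof. by move=> /split_atP[_ h e]; exists (suffix_at l q). Qed.

Lemma is_prefixE a l : is_prefix a l -> a = prefix_at l (kd a).
Proof. by move=> [b ab ->]; have [] := split_at_comp ab. Qed.

Lemma prefix_at_mono l q t : dle q t -> dle t (kd l) ->
  is_prefix (prefix_at l q) (prefix_at l t).
Proof.
move=> qt tl; have [dt _ _] := split_atP tl.
have h := prefix_at_prefix tl.
have qt' : dle q (kd (prefix_at l t)) by rewrite dt.
have p1 := prefix_at_prefix qt'.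
have := is_prefixE (is_prefix_trans p1 h).
by have [-> _ _] := split_atP qt'; move=> <-.
Qed.

Lemma is_prefix_mono a b l : is_prefix a l -> is_prefix b l ->
  dle (kd a) (kd b) -> is_prefix a b.
Proof.
move=> pa pb h; rewrite (is_prefixE pa) (is_prefixE pb).
by apply: prefix_at_mono => //; apply: is_prefix_deg.
Qed.

(** * Edges, local convexity and the sets $\Lambda^{\le n}$ *)

Definition has_edge v i := exists e, kr e = v /\ kd e = unit_deg i.

(** Membership in $\Lambda^{\le n}$ without the upper bound on [kd l]. In this form it passes to
    smaller [n] and can express that [l] is long enough. *)
Definition deep n l := forall i, (kd l i < n i)%N -> ~ has_edge (ks l) i.

Lemma le_setE n l : le_set (fun=> True) n l <-> dle (kd l) n /\ deep n l.
Proof.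
split=> [[_ h1 h2]|[h1 h2]].
  by split=> // i /h2 h [e [e1 e2]]; apply: h; exists e.
by split=> // i /h2 h [e [_ e1 e2]]; apply: h; exists e.
Qed.

Lemma deep_le n q l : dle n q -> deep q l -> deep n l.
Proof. by move=> h d i hi; apply: d; apply: leq_trans hi (h i). Qed.

Lemma has_edge_prefix l i : (0 < kd l i)%N -> has_edge (kr l) i.
Proof.
move=> h; have hi : dle (unit_deg i) (kd l).
  by move=> j; rewrite ffunE; case: eqP => [->|].
exists (prefix_at l (unit_deg i)).
have p := prefix_at_prefix hi; rewrite (is_prefix_rng p).
by split=> //; have [] := split_atP hi.
Qed.

Lemma deep_ext n l m : ks l = kr m -> deep n l ->
  forall i, (kd l i < n i)%N -> kd m i = 0%N.
Proof.
move=> lm d i /d h; case: (posnP (kd m i)) => // /has_edge_prefix.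
by rewrite -lm.
Qed.

(** Split off a first edge of [l]. Its colour differs from [i], so local convexity moves the edge of
    colour [i] from its range to its source; induction on the total degree finishes. *)
Lemma has_edge_along : locally_convex L -> forall l i,
  kd l i = 0%N -> has_edge (kr l) i -> has_edge (ks l) i.
Proof.
move=> lc l i; move: {2}(\sum_j kd l j)%N (leqnn (\sum_j kd l j)%N) => N.
elim: N l => [|N IH] l hN di he.
  suff /kd0_id e : kd l = dzero k by move: he; rewrite {2}e kid_src.
  apply/ndegP => j; rewrite ffunE; apply/eqP; rewrite -leqn0.
  by apply: leq_trans hN; rewrite (bigD1 j) //= leq_addr.
case: (pickP (fun j => 0 < kd l j)%N) => [j hj|h0]; last first.
  suff /kd0_id e : kd l = dzero k by move: he; rewrite {2}e kid_src.
  by apply/ndegP => j; rewrite ffunE; have := h0 j; case: (kd l j).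
have hij : i != j by apply: contraTneq hj => <-; rewrite di.
have hl : dle (unit_deg j) (kd l) by move=> c; rewrite ffunE; case: eqP => [->|].
have [d1 c1 e1] := split_atP hl.
have d2 := suffix_at_deg hl.
set f := prefix_at _ _ in d1 c1 e1; set g := suffix_at _ _ in d2 c1 e1.
have [e [er ed]] := he.
have rf : kr e = kr f by rewrite er e1 kcomp_rng.
have [_ [b [br bd]]] := lc i j e f hij rf ed d1.
have -> : ks l = ks g by rewrite e1 kcomp_src.
apply: IH; last by exists b; rewrite -c1.
  rewrite -ltnS; apply: leq_trans hN; rewrite (bigD1 j) //= [X in (_ < X)%N](bigD1 j) //=.
  rewrite d2 !ffunE eqxx -addSn; apply: leq_add; first by lia.
  by apply: leq_sum => c _; rewrite !ffunE leq_subr.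
by rewrite d2 !ffunE di.
Qed.

Lemma is_prefix_comp a b c : ks a = kr b -> is_prefix b c ->
  is_prefix (kcomp a b) (kcomp a c).
Proof.
move=> ab [x bx ->]; exists x; first by rewrite kcomp_src.
by rewrite kcomp_assoc.
Qed.

Lemma is_prefix_compI a b c : ks a = kr b -> ks a = kr c ->
  is_prefix (kcomp a b) (kcomp a c) -> is_prefix b c.
Proof.
move=> ab ac [x]; rewrite kcomp_src // => bx; rewrite kcomp_assoc // => e.
by exists x => //; apply: (kcomp_injl (a := a)); rewrite ?kcomp_rng.
Qed.

Lemma is_prefix_comp_of_le a l c : is_prefix a c -> is_prefix l c ->
  dle (kd a) (kd l) -> exists2 m, ks a = kr m & l = kcomp a m.
Proof. by move=> h1 h2 h3; apply: (is_prefix_mono h1 h2 h3). Qed.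

(** In a colour where [l] is short of [n], its source has no edge, so the rest of [c] adds nothing
    to the degree there. *)
Lemma le_set_prefix_le n l c t : le_set (fun=> True) n l -> is_prefix l c ->
  dle t (kd c) -> dle t n -> dle t (kd l).
Proof.
move=> /le_setE[_ dl] [b lb ->] tc tn i.
rewrite leqNgt; apply/negP => lt.
have lt' : (kd l i < n i)%N by apply: leq_trans lt (tn i).
have b0 := deep_ext lb dl lt'.
by have := tc i; rewrite kcomp_deg // ffunE b0; lia.
Qed.

(** By the preceding bound each of the two degrees is below the other, and [c] has only one prefix
    of a given degree. *)
Lemma le_set_prefix_uniq n a b c : le_set (fun=> True) n a ->
  le_set (fun=> True) n b -> is_prefix a c -> is_prefix b c -> a = b.
Proof.
move=> na nb ac bc.
have an : dle (kd a) n by case/le_setE: na.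
have bn : dle (kd b) n by case/le_setE: nb.
have ab := le_set_prefix_le nb bc (is_prefix_deg ac) an.
have ba := le_set_prefix_le na ac (is_prefix_deg bc) bn.
have e : kd a = kd b by apply/ndegP => i; have := ab i; have := ba i; lia.
by rewrite (is_prefixE ac) e -(is_prefixE bc).
Qed.

Lemma le_set_comp n a m : ks a = kr m ->
  le_set (fun=> True) (dadd (kd a) n) (kcomp a m) <-> le_set (fun=> True) n m.
Proof.
move=> am; rewrite !le_setE /deep kcomp_deg // kcomp_src //; split=> -[h1 h2].
  split=> [i|i hi]; first by have := h1 i; rewrite !ffunE; lia.
  by apply: h2; rewrite !ffunE; lia.
split=> [i|i]; first by have := h1 i; rewrite !ffunE; lia.
by rewrite !ffunE => hi; apply: h2; lia.
Qed.

(** Where the truncation is short of [n], nothing of that colour has been cut off. An edge at the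
    cut would then travel along the remainder, by local convexity, to the source of [m], against the
    depth of [m]. *)
Lemma le_set_prefix_at (lc : locally_convex L) n a m : ks a = kr m ->
  deep n m -> le_set (fun=> True) n (prefix_at (kcomp a m) (dmin n (kd (kcomp a m)))).
Proof.
move=> am dm; set c := kcomp a m; set q := dmin n _.
have qc : dle q (kd c) by move=> i; rewrite ffunE geq_minr.
have [d1 c1 e1] := split_atP qc; have d2 := suffix_at_deg qc.
set f := prefix_at _ _ in d1 c1 e1 *; set g := suffix_at _ _ in d2 c1 e1.
apply/le_setE; split=> [i|i hi he]; first by rewrite d1 ffunE geq_minl.
have hc : (kd c i < n i)%N by move: hi; rewrite d1 ffunE; lia.
have g0 : kd g i = 0%N by rewrite d2 !ffunE; lia.
apply: (dm i); first by move: hc; rewrite kcomp_deg // ffunE; lia.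
have -> : ks m = ks g by rewrite -(kcomp_src am) -/c e1 kcomp_src.
by apply: has_edge_along => //; rewrite -c1.
Qed.

(* Boundary paths are encoded by the sets of their initial segments. *)
Definition boundary_filter (U : set P) :=
  [/\ forall l m, is_prefix l m -> U m -> U l,
      forall l m, U l -> U m -> exists2 c, U c & is_prefix l c /\ is_prefix m c &
      forall n, exists2 l, U l & le_set (fun=> True) n l].

(** [fquot] removes the initial segment [a] from a boundary path and [fconcat] puts it in front. The
    latter closes under prefixes, because the products [kcomp a m] omit the initial segments that do
    not extend [a]. *)
Definition fquot a (U : set P) : set P := [set m | ks a = kr m /\ U (kcomp a m)].

Definition fconcat a (U : set P) : set P :=
  [set l | exists2 m, U m /\ ks a = kr m & is_prefix l (kcomp a m)].

Implicit Types U : set P.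

Lemma boundary_filter_rng U l m : boundary_filter U -> U l -> U m -> kr l = kr m.
Proof.
move=> [_ dir _] Ul Um; have [c _ [h1 h2]] := dir _ _ Ul Um.
by rewrite -(is_prefix_rng h1) -(is_prefix_rng h2).
Qed.

Lemma boundary_filter_kid U l : boundary_filter U -> U l -> U (kid (kr l)).
Proof.
move=> [pre _ _]; apply: pre; exists l; first by rewrite kid_src.
by rewrite kcomp_idl.
Qed.

Lemma boundary_filter_kidE U l v : boundary_filter U -> U (kid v) -> U l -> kr l = v.
Proof. by move=> bU Uv Ul; rewrite (boundary_filter_rng bU Ul Uv) kid_rng. Qed.

Lemma boundary_filter_uniq U n a b : boundary_filter U -> U a -> U b ->
  le_set (fun=> True) n a -> le_set (fun=> True) n b -> a = b.
Proof.
move=> [_ dir _] Ua Ub na nb; have [c _ [ac bc]] := dir _ _ Ua Ub.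
exact: le_set_prefix_uniq na nb ac bc.
Qed.

Lemma boundary_filter_fquot U a : boundary_filter U -> U a ->
  boundary_filter (fquot a U).
Proof.
move=> [pre dir ex] Ua; split.
- move=> l m lm [am Um]; have al : ks a = kr l by rewrite -(is_prefix_rng lm).
  by split=> //; apply: pre Um; apply: is_prefix_comp.
- move=> l m [al Ul] [am Um]; have [c Uc [lc mc]] := dir _ _ Ul Um.
  have [b hb e] := lc; rewrite kcomp_src // in hb.
  have ab : ks a = kr (kcomp l b) by rewrite kcomp_rng.
  rewrite kcomp_assoc // in e; rewrite e in Uc lc mc.
  by exists (kcomp l b) => //; split; apply: is_prefix_compI; eassumption.
(* A member of $U\cap\Lambda^{\le d(a)+n}$ has degree at least $d(a)$, hence extends [a], and what
   follows [a] lies in $\Lambda^{\le n}$. *)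
- move=> n; have [l Ul nl] := ex (dadd (kd a) n).
  have [c _ [lc ac]] := dir _ _ Ul Ua.
  have al := le_set_prefix_le nl lc (is_prefix_deg ac) (@dle_add _ n).
  have [m am e] := is_prefix_comp_of_le ac lc al.
  by rewrite e in Ul nl; exists m => //; apply/(le_set_comp n am).
Qed.

Lemma boundary_filter_fconcat (lc : locally_convex L) U a : boundary_filter U ->
  U (kid (ks a)) -> boundary_filter (fconcat a U).
Proof.
move=> bU Ua; have [pre dir ex] := bU; split.
- by move=> l m lm [b hb mb]; exists b => //; apply: is_prefix_trans lm mb.
- move=> l m [b [Ub ab] lb] [b' [Ub' ab'] mb'].
  have [c Uc [bc bc']] := dir _ _ Ub Ub'.
  have ac : ks a = kr c by rewrite (is_prefix_rng bc).
  exists (kcomp a c); first by exists c => //; apply: is_prefix_refl.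
  by split; [apply: is_prefix_trans lb _|apply: is_prefix_trans mb' _];
    apply: is_prefix_comp.
(* Prolonging a deep [m] by [a] may exceed [n]; truncating the product brings it back into
   $\Lambda^{\le n}$ by local convexity. *)
- move=> n; have [m Um /le_setE[_ dm]] := ex n.
  have am : ks a = kr m by rewrite (boundary_filter_kidE bU Ua Um).
  exists (prefix_at (kcomp a m) (dmin n (kd (kcomp a m)))).
    exists m => //; apply: prefix_at_prefix => i; rewrite ffunE; exact: geq_minr.
  exact: le_set_prefix_at.
Qed.

Lemma fquot_fconcat U a : boundary_filter U -> U (kid (ks a)) ->
  fquot a (fconcat a U) = U.
Proof.
move=> bU Ua; have [pre _ _] := bU; apply/seteqP; split=> m /=.
  by move=> [am [b [Ub ab] /(is_prefix_compI am ab)/pre]]; apply.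
move=> Um; have am : ks a = kr m by rewrite (boundary_filter_kidE bU Ua Um).
by split=> //; exists m => //; apply: is_prefix_refl.
Qed.

Lemma fconcat_fquot U a : boundary_filter U -> U a -> fconcat a (fquot a U) = U.
Proof.
move=> [pre dir _] Ua; apply/seteqP; split=> l /=.
  by move=> [m [[_ Um] _] /pre]; apply.
move=> Ul; have [c Uc [lc [b ab e]]] := dir _ _ Ul Ua.
by exists b; [split=> //; split=> //; rewrite -e|rewrite -e].
Qed.

Lemma fconcat_mem U a : U (kid (ks a)) -> fconcat a U a.
Proof.
by move=> Ua; exists (kid (ks a)); rewrite ?kid_rng ?kcomp_idr //;
  apply: is_prefix_refl.
Qed.

Lemma fquot_comp U a b : ks a = kr b -> fquot (kcomp a b) U = fquot b (fquot a U).
Proof.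
move=> ab; apply/seteqP; split=> m; rewrite /fquot /= kcomp_src //.
  by move=> [bm]; rewrite kcomp_assoc // kcomp_rng.
by move=> [bm [_ ]]; rewrite kcomp_assoc.
Qed.

Lemma fconcat_comp U a b : ks a = kr b -> fconcat (kcomp a b) U = fconcat a (fconcat b U).
Proof.
move=> ab; apply/seteqP; split=> l /=.
  move=> [m [Um]]; rewrite kcomp_src // => bm; rewrite kcomp_assoc // => h.
  exists (kcomp b m); rewrite ?kcomp_rng //; split=> //.
  by exists m => //; apply: is_prefix_refl.
move=> [c [[m [Um bm] cm] ac] lc]; exists m; first by rewrite kcomp_src //.
rewrite kcomp_assoc //; apply: is_prefix_trans lc _; exact: is_prefix_comp.
Qed.

End Paths.

(** * The boundary path representation *)

Section LinearOperators.
Variables (R : comNzRingType) (X : pointedType).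
Local Open Scope ring_scope.

(** The endomorphisms of the module of functions [X -> R], made into an algebra to serve as a target
    of [KP_universal]. A point of [X] ensures that one differs from zero. *)
Record linear_op := LinearOp {
  op_fun :> (X -> R) -> X -> R;
  op_linear : forall c f g x,
    op_fun (fun y => c * f y + g y) x = c * op_fun f x + op_fun g x }.

Implicit Types A B C : linear_op.

Lemma linear_op_ext A B : (forall f x, A f x = B f x) -> A = B.
Proof.
case: A B => [a ha] [b hb] /= e.
have ab : a = b by apply/funext => f; apply/funext => x.
by case: _ / ab hb => hb; rewrite (Prop_irrelevance ha hb).
Qed.

Lemma op_linearD A f g x : A (fun y => f y + g y) x = A f x + A g x.
Proof.
by rewrite -[A f x]mul1r -op_linear; congr (op_fun A _ x); apply/funext => y;
  rewrite mul1r.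
Qed.

Lemma op_linear0 A x : A (fun=> 0) x = 0.
Proof.
by have := op_linearD A (fun=> 0) (fun=> 0) x; rewrite addr0 => /eqP;
  rewrite -subr_eq0 opprD addNKr oppr_eq0 => /eqP.
Qed.

Lemma op_linearZ A c f x : A (fun y => c * f y) x = c * A f x.
Proof.
rewrite -[RHS]addr0 -(op_linear0 A x) -op_linear.
by congr (op_fun A _ x); apply/funext => y; rewrite addr0.
Qed.

Program Definition op_zero := LinearOp (op_fun := fun _ _ => 0) _.
Next Obligation. by rewrite mulr0 addr0. Qed.
Program Definition op_opp A := LinearOp (op_fun := fun f x => - A f x) _.
Next Obligation. by rewrite op_linear opprD mulrN. Qed.
Program Definition op_add A B := LinearOp (op_fun := fun f x => A f x + B f x) _.
Next Obligation. by rewrite !op_linear mulrDr addrACA. Qed.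
Program Definition op_one := LinearOp (op_fun := fun f => f) _.
Program Definition op_mul A B := LinearOp (op_fun := fun f => A (B f)) _.
Next Obligation. by rewrite -op_linear; congr (op_fun A _ x); apply/funext => y; rewrite op_linear. Qed.
Program Definition op_scale c A := LinearOp (op_fun := fun f x => c * A f x) _.
Next Obligation. by rewrite op_linear mulrDr !mulrA (mulrC c). Qed.

HB.instance Definition _ := gen_eqMixin linear_op.
HB.instance Definition _ := gen_choiceMixin linear_op.

Lemma op_addA : associative op_add.
Proof. by move=> A B C; apply: linear_op_ext => f x /=; rewrite addrA. Qed.
Lemma op_addC : commutative op_add.
Proof. by move=> A B; apply: linear_op_ext => f x /=; rewrite addrC. Qed.
Lemma op_add0 : left_id op_zero op_add.
Proof. by move=> A; apply: linear_op_ext => f x /=; rewrite add0r. Qed.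
Lemma op_addN : left_inverse op_zero op_opp op_add.
Proof. by move=> A; apply: linear_op_ext => f x /=; rewrite addNr. Qed.
HB.instance Definition _ :=
  GRing.isZmodule.Build linear_op op_addA op_addC op_add0 op_addN.

Lemma op_mulA : associative op_mul.
Proof. by move=> A B C; apply: linear_op_ext. Qed.
Lemma op_mul1 : left_id op_one op_mul.
Proof. by move=> A; apply: linear_op_ext. Qed.
Lemma op_mulr1 : right_id op_one op_mul.
Proof. by move=> A; apply: linear_op_ext. Qed.
Lemma op_mulDl : left_distributive op_mul +%R.
Proof. by move=> A B C; apply: linear_op_ext. Qed.
Lemma op_mulDr : right_distributive op_mul +%R.
Proof. by move=> A B C; apply: linear_op_ext => f x; rewrite /= op_linearD. Qed.
Lemma op_one_neq0 : op_one != 0 :> linear_op.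
Proof.
apply/eqP => e; have /eqP := congr1 (fun A => op_fun A (fun=> 1) point) e.
by rewrite /= oner_eq0.
Qed.
HB.instance Definition _ := GRing.Zmodule_isNzRing.Build linear_op
  op_mulA op_mul1 op_mulr1 op_mulDl op_mulDr op_one_neq0.

Lemma op_scaleA a b A : op_scale a (op_scale b A) = op_scale (a * b) A.
Proof. by apply: linear_op_ext => f x /=; rewrite mulrA. Qed.
Lemma op_scale1 : left_id 1 op_scale.
Proof. by move=> A; apply: linear_op_ext => f x /=; rewrite mul1r. Qed.
Lemma op_scaleDr : right_distributive op_scale +%R.
Proof. by move=> c A B; apply: linear_op_ext => f x /=; rewrite mulrDr. Qed.
Lemma op_scaleDl A : {morph op_scale^~ A : a b / a + b}.
Proof. by move=> a b; apply: linear_op_ext => f x /=; rewrite mulrDl. Qed.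
HB.instance Definition _ := GRing.Zmodule_isLmodule.Build R linear_op
  op_scaleA op_scale1 op_scaleDr op_scaleDl.

Lemma op_scaleAl (a : R) A B : a *: (A * B) = (a *: A) * B.
Proof. by apply: linear_op_ext. Qed.
HB.instance Definition _ := GRing.Lmodule_isLalgebra.Build R linear_op op_scaleAl.

Lemma op_scaleAr (a : R) A B : a *: (A * B) = A * (a *: B).
Proof. by apply: linear_op_ext => f x; rewrite /= op_linearZ. Qed.
HB.instance Definition _ := GRing.Lalgebra_isAlgebra.Build R linear_op op_scaleAr.

Lemma op_sumE (I : Type) (r : seq I) (F : I -> linear_op) f x :
  (\sum_(i <- r) F i) f x = \sum_(i <- r) F i f x.
Proof.
by elim: r => [|i r IH]; rewrite ?big_nil // !big_cons -IH.
Qed.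

(** Pull-back along a partial map with domain [D], extended by zero. Pull-back is contravariant, so
    in a product the map of the left factor acts first. *)
Program Definition partial_op (D : X -> Prop) (g : X -> X) :=
  LinearOp (op_fun := fun f x => if `[< D x >] then f (g x) else 0) _.
Next Obligation. by case: ifP => //; rewrite mulr0 addr0. Qed.

Lemma partial_op_mul D g D' g' : partial_op D g * partial_op D' g' =
  partial_op (fun x => D x /\ D' (g x)) (fun x => g' (g x)).
Proof. by apply: linear_op_ext => f x /=; rewrite asbool_and; do 2 case: asboolP. Qed.

Lemma partial_op_eq D g D' g' : (forall x, D x <-> D' x) ->
  (forall x, D x -> g x = g' x) -> partial_op D g = partial_op D' g'.
Proof.
move=> h e; apply: linear_op_ext => f x /=.
by rewrite -(asbool_equiv_eq (h x)); case: asboolP => // /e ->.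
Qed.

Lemma partial_op0 D g : (forall x, ~ D x) -> partial_op D g = 0.
Proof. by move=> h; apply: linear_op_ext => f x /=; case: asboolP => // /h. Qed.

End LinearOperators.

(** * Shift operators on boundary filters *)

Section Representation.
Variables (k : nat) (L : kgraph k) (R : comNzRingType).
Hypothesis lc : locally_convex L.
Local Notation V := (kvert L).
Local Notation P := (kpath L).
Local Notation B := (linear_op R (set P)).
Local Open Scope ring_scope.

(** On indicator functions these are the usual operators: pulling back along [fquot a] takes the
    indicator of a boundary path $y$ with range [ks a] to that of $ay$, and pulling back along
    [fconcat a] takes it back. *)
Definition path_proj (v : V) : B :=
  partial_op R (fun U => boundary_filter U /\ U (kid v)) id.
Definition path_shift (a : P) : B :=
  partial_op R (fun U => boundary_filter U /\ U a) (fquot a).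
Definition path_unshift (a : P) : B :=
  partial_op R (fun U => boundary_filter U /\ U (kid (ks a))) (fconcat a).

Lemma fconcat_kid (U : set P) a : boundary_filter U -> U (kid (ks a)) -> fconcat a U (kid (kr a)).
Proof.
by move=> bU Ua; apply: boundary_filter_kid (boundary_filter_fconcat lc bU Ua) (fconcat_mem Ua).
Qed.

Lemma fquot_kid (U : set P) a : U a -> fquot a U (kid (ks a)).
Proof. by move=> Ua; split; rewrite ?kid_rng ?kcomp_idr. Qed.

(** (KP3) and (KP4) rest on one fact: a boundary filter contains exactly one element of
    $\Lambda^{\le n}$. The other relations are identities between quotients and prolongations. *)
Lemma path_representation : KP_family path_proj path_shift path_unshift.
Proof.
split; first split.
- move=> v; rewrite partial_op_mul; apply: partial_op_eq => // U; tauto.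
- move=> v w vw; rewrite partial_op_mul; apply: partial_op0 => U [[bU Uv] [_ Uw]].
  by apply: vw; have := boundary_filter_kidE bU Uw Uv; rewrite kid_rng.
- split=> [a b ab|a]; last split.
  + rewrite !partial_op_mul; split; apply: partial_op_eq => U /=.
    * split=> [[[bU Ua] [_ [_ Uab]]]//|[bU Uab]].
      have Ua : U a by case: bU => pre _ _; apply: pre Uab; exists b.
      by split=> //; split; [apply: boundary_filter_fquot|].
    * by rewrite fquot_comp.
    * rewrite kcomp_src //; split=> [[[bU Ub] _]//|[bU Ub]].
      by split=> //; split; [apply: boundary_filter_fconcat|rewrite ab; apply: fconcat_kid].
    * by rewrite fconcat_comp.
  + rewrite partial_op_mul; apply: partial_op_eq => // U; split; first by tauto.
    by move=> [bU Ua]; do 2 (split=> //); apply: boundary_filter_kid.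
  + rewrite partial_op_mul; apply: partial_op_eq => // U; split; first by tauto.
    by move=> [bU Ua]; do 2 (split=> //); [apply: boundary_filter_fquot|apply: fquot_kid].
  + rewrite partial_op_mul; apply: partial_op_eq => // U; tauto.
  + rewrite partial_op_mul; apply: partial_op_eq => // U; split; first by tauto.
    by move=> [bU Ua]; do 2 (split=> //); [apply: boundary_filter_fconcat|apply: fconcat_kid].
- move=> n a b _ na nb; rewrite partial_op_mul; case: eqP => [<-|ab].
    apply: partial_op_eq => U; last by move=> [[bU Ua] _]; apply: fquot_fconcat.
    split=> [[]//|[bU Ua]]; split=> //; split; last exact: fconcat_mem.
    exact: boundary_filter_fconcat.
  apply: partial_op0 => U [[bU Ua] [bU' Ub]]; apply: ab.
  exact: boundary_filter_uniq bU' (fconcat_mem Ua) Ub na nb.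
- move=> v n _ S uS hS; apply: linear_op_ext => f U; rewrite op_sumE.
  (* $s_as_{a^*}$ acts as multiplication by the indicator of the boundary filters through [a]. *)
  have E a : (path_shift a * path_unshift a) f U =
      if `[< boundary_filter U /\ U a >] then f U else 0.
    rewrite partial_op_mul /= (_ : `[< _ >] = `[< boundary_filter U /\ U a >]).
      by case: asboolP => // -[bU Ua]; rewrite fconcat_fquot.
    apply: asbool_equiv_eq; split=> [[]//|[bU Ua]]; split=> //.
    by split; [apply: boundary_filter_fquot|apply: fquot_kid].
  under eq_bigr do rewrite E.
  rewrite /=; case: asboolP => [[bU Uv]|h].
    have [a Ua na] : exists2 l, U l & le_set (fun=> True) n l by case: bU.
    have aS : a \in S by apply/hS; rewrite (boundary_filter_kidE bU Uv Ua).
    rewrite (bigD1_seq a) //= asboolT // big1_seq ?addr0 // => b /andP[ba bS].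
    case: asboolP => // -[_ Ub]; case/hS: bS => nb _.
    by case/eqP: ba; apply: boundary_filter_uniq bU Ub Ua nb na.
  rewrite big1_seq // => a /andP[_ /hS[_ av]]; case: asboolP => // -[bU Ua].
  by case: h; split=> //; rewrite -av; apply: boundary_filter_kid.
Qed.

End Representation.

(** * Boundary paths as filters *)

Section BoundaryPaths.
Variables (k : nat) (L : kgraph k).
Local Notation V := (kvert L).
Local Notation P := (kpath L).
Local Notation "0" := (dzero k).
Implicit Types (a b l : P) (v : V) (n p q t d : ndeg k) (i j : 'I_k) (m : edeg k)
  (x y : ndeg k -> ndeg k -> P).

Lemma dle_refl q : dle q q. Proof. by []. Qed.

Lemma dle0 q : dle 0 q. Proof. by move=> i; rewrite ffunE. Qed.

Lemma dsub0 q : dsub q 0 = q. Proof. by degree_ext. Qed.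

Lemma ext_le_trans p q m : dle p q -> ext_le q m -> ext_le p m.
Proof. by move=> pq qm i; have := qm i; case: (m i) => // mi; apply: leq_trans (pq i). Qed.

Lemma ext_le_subl d q m : ext_le q (ext_add d m) -> ext_le (dsub q d) m.
Proof. by move=> h i; have := h i; rewrite !ffunE; case: (m i) => //= mi; rewrite leq_subLR. Qed.

Lemma ext_le_add d q m : ext_le q m -> ext_le (dadd d q) (ext_add d m).
Proof. by move=> h i; have := h i; rewrite !ffunE; case: (m i) => //= mi; rewrite leq_add2l. Qed.

Lemma ext_le_max q t m : ext_le q m -> ext_le t m -> ext_le (dmax q t) m.
Proof.
move=> h1 h2 i; have := h1 i; have := h2 i; rewrite ffunE.
by case: (m i) => // mi; rewrite geq_max => -> ->.
Qed.

(** The identity at [p] is short of [unit_deg i], so it belongs to the set only if [p] plus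
    [unit_deg i] leaves the domain, that is, [p] has reached a finite bound in direction [i].
    Conversely such a bound leaves no room for another [q]. *)
Lemma omega_le_onlyP m p i : ext_le p m ->
  omega_le_only m p (unit_deg i) <-> m i = Some (p i).
Proof.
move=> pm; split=> [h|mi q].
  have [_ /(_ erefl)[_ _ _ h']] := h p.
  have hi : (dsub p p i < unit_deg i i)%N by rewrite !ffunE eqxx subnn.
  have := h' i hi; case e: (m i) => [mi|] hn.
    congr Some; apply/eqP; rewrite eq_sym eqn_leq; have := pm i; rewrite e => -> /=.
    rewrite leqNgt; apply/negP => lt; apply: hn => j; have := pm j; rewrite !ffunE.
    by case: eqVneq => [->|_]; rewrite ?e ?addn0 // addn1.
  by case: hn => j; have := pm j; rewrite !ffunE; case: eqVneq => [->|_]; rewrite ?e ?addn0.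
split=> [[pq qm qp _]|->].
  apply/ndegP => j; have := qp j; have := pq j; have := qm i; rewrite mi !ffunE.
  by case: eqVneq => [->|_] /=; lia.
split=> // [j|j]; first by rewrite !ffunE subnn.
rewrite !ffunE subnn; case: eqVneq => // -> _ /(_ i).
by rewrite mi !ffunE eqxx addn1 ltnn.
Qed.

Section Functor.
Variables (m : edeg k) (x : ndeg k -> ndeg k -> P).
Hypothesis fx : is_functor m x.

Lemma functor_deg p q : dle p q -> ext_le q m -> kd (x p q) = dsub q p.
Proof. by case: fx => h _ _; apply: h. Qed.

Lemma functor_rng p q : dle p q -> ext_le q m -> kr (x p q) = kr (x p p).
Proof.
case: fx => _ h2 h3 pq qm; have [<- _] := h2 p p q (dle_refl p) pq qm.
by rewrite h3 ?kid_src ?kid_rng //; apply: ext_le_trans qm.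
Qed.

Lemma functor_src p q : dle p q -> ext_le q m -> ks (x p q) = kr (x q q).
Proof. by case: fx => _ h _ pq qm; have [-> _] := h p q q pq (dle_refl q) qm. Qed.

Lemma functor_comp p q t : dle p q -> dle q t -> ext_le t m ->
  x p t = kcomp (x p q) (x q t).
Proof. by case: fx => _ h _ pq qt tm; have [_ ->] := h p q t pq qt tm. Qed.

Lemma functor_deg0 q : ext_le q m -> kd (x 0 q) = q.
Proof. by move=> qm; rewrite functor_deg ?dsub0 //; apply: dle0. Qed.

Lemma functor_is_prefix q t : dle q t -> ext_le t m -> is_prefix (x 0 q) (x 0 t).
Proof.
move=> qt tm; exists (x q t); last exact: functor_comp (dle0 q) qt tm.
by case: fx => _ h _; have [] := h 0 q t (dle0 q) qt tm.
Qed.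

Lemma functor_prefix l q : ext_le q m -> is_prefix l (x 0 q) ->
  ext_le (kd l) m /\ l = x 0 (kd l).
Proof.
move=> qm lq; have dl := is_prefix_deg lq; rewrite functor_deg0 // in dl.
have lm := ext_le_trans dl qm; split=> //.
have := is_prefixE (functor_is_prefix dl qm); rewrite functor_deg0 // => ->.
exact: is_prefixE.
Qed.

End Functor.

(** A functor on $\Omega_{k,m}$ is recovered from its segments $x(0,q)$: $x(p,q)$ can only be what
    follows [h p] in [h q]. *)
Lemma functor_of_segments m (h : ndeg k -> P) :
  (forall q, ext_le q m -> kd (h q) = q) ->
  (forall q t, dle q t -> ext_le t m -> is_prefix (h q) (h t)) ->
  let y p q := suffix_at (h q) p in
  is_functor m y /\ forall q, ext_le q m -> y 0 q = h q.
Proof.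
move=> hd hp y.
have H p q : dle p q -> ext_le q m -> ks (h p) = kr (y p q) /\ h q = kcomp (h p) (y p q).
  move=> pq qm; have pm := ext_le_trans pq qm.
  have pq' : dle p (kd (h q)) by rewrite hd.
  have [_ h2 h3] := split_atP pq'.
  have e : prefix_at (h q) p = h p by rewrite (is_prefixE (hp _ _ pq qm)) hd.
  by rewrite -e.
split; last first.
  move=> q qm; have [h1 ->] := H _ _ (dle0 q) qm.
  have zm := ext_le_trans (dle0 q) qm.
  rewrite [h 0]kd0_id; last exact: hd.
  have e := kd0_id (hd _ zm).
  by rewrite e kid_src in h1; rewrite h1 kcomp_idl.
have yd p q : dle p q -> ext_le q m -> kd (y p q) = dsub q p.
  by move=> pq qm; rewrite /y suffix_at_deg ?hd.
split=> // [p q t pq qt tm|p pm]; last first.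
  by apply: kd0_id; rewrite yd //; degree_ext.
have qm := ext_le_trans qt tm.
have [a1 a2] := H _ _ pq qm; have [b1 b2] := H _ _ qt tm.
have [c1 c2] := H _ _ (dle_trans pq qt) tm.
have e : ks (y p q) = kr (y q t) by rewrite -b1 a2 kcomp_src.
split=> //; apply: (kcomp_injl (a := h p)) => //; first by rewrite kcomp_rng.
by rewrite -c2 b2 a2 kcomp_assoc.
Qed.

Lemma concat_exists a m x : is_functor m x -> ks a = kr (x 0 0) ->
  exists y, concat_is a m x (ext_add (kd a) m) y.
Proof.
move=> fx ax; set m' := ext_add _ _.
(* Subtraction is truncated, so [c q] has degree $d(a)\vee q$. It is long enough to contain the
   wanted segment of degree [q] as a prefix, even if [q] is not above $d(a)$. *)
pose c q := kcomp a (x 0 (dsub q (kd a))).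
have cx q : ext_le q m' -> ks a = kr (x 0 (dsub q (kd a))).
  by move=> /ext_le_subl qm; rewrite (functor_rng fx) //; apply: dle0.
have cd q : ext_le q m' -> kd (c q) = dadd (kd a) (dsub q (kd a)).
  move=> qm; rewrite kcomp_deg; last exact: cx.
  by rewrite (functor_deg0 fx) //; apply: ext_le_subl.
have cd' q : ext_le q m' -> dle q (kd (c q)).
  by move=> qm; rewrite cd // => i; rewrite !ffunE; lia.
have cp q t : dle q t -> ext_le t m' -> is_prefix (c q) (c t).
  move=> qt tm; apply: is_prefix_comp; first exact: cx (ext_le_trans qt tm).
  apply: (functor_is_prefix fx); last exact: ext_le_subl.
  by move=> i; rewrite !ffunE leq_sub2r.
pose h q := prefix_at (c q) q.
have hc q : ext_le q m' -> is_prefix (h q) (c q).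
  by move=> qm; apply: prefix_at_prefix; apply: cd'.
have hd q : ext_le q m' -> kd (h q) = q.
  by move=> qm; have [] := split_atP (cd' _ qm).
have [|fy hy] := @functor_of_segments m' h hd.
  move=> q t qt tm; have qm := ext_le_trans qt tm.
  apply: (@is_prefix_mono _ _ _ _ (c t)); last by rewrite !hd.
    exact: is_prefix_trans (hc _ qm) (cp _ _ qt tm).
  exact: hc.
exists (fun p q => suffix_at (h q) p); split=> // q qm.
have qm' := @ext_le_add (kd a) _ _ qm.
rewrite hy //; have e := cd _ qm'; rewrite dadd_subl in e.
have := is_prefixE (is_prefix_refl (c (dadd (kd a) q))).
by rewrite e -/(h _) /c dadd_subl => <-.
Qed.

Definition initial_segments m x : set P :=
  [set l | exists2 q, ext_le q m & l = x 0 q].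

(** Such an edge would lie in $x(p)\Lambda^{\le e_i}$, which consists of the identity alone. *)
Lemma boundary_path_no_edge m x p i : boundary_path (fun=> True) m x ->
  ext_le p m -> m i = Some (p i) -> ~ has_edge (kr (x p p)) i.
Proof.
move=> [fx _ bd] pm /(omega_le_onlyP i pm) om [e [er ed]].
have ekid : e = kid (kr (x p p)).
  apply/(bd p i pm om e); split=> //; apply/le_setE; rewrite ed; split=> // j.
  by rewrite ed ltnn.
have := congr1 (fun q : ndeg k => q i) ed.
by rewrite ekid kid_deg !ffunE eqxx.
Qed.

Lemma boundary_filter_segments m x : boundary_path (fun=> True) m x ->
  boundary_filter (initial_segments m x).
Proof.
move=> bx; have [fx _ _] := bx; split.
- move=> l c lc [q qm e]; rewrite e in lc.
  by have [h1 h2] := functor_prefix fx qm lc; exists (kd l).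
- move=> _ _ [q qm ->] [t tm ->]; have M := ext_le_max qm tm.
  exists (x 0 (dmax q t)); first by exists (dmax q t).
  by split; apply: functor_is_prefix M => //; [apply: dle_maxl|apply: dle_maxr].
(* The minimum of [n] and [m] is the largest degree below [n] at which [x] is defined; where it is
   short of [n], the path has ended in that direction. *)
- move=> n; pose p : ndeg k := [ffun i => if m i is Some mi then minn (n i) mi else n i].
  have pm : ext_le p m by move=> i; rewrite ffunE; case: (m i) => // mi; apply: geq_minr.
  exists (x 0 p); first by exists p.
  apply/le_setE; rewrite /deep (functor_deg0 fx pm) (functor_src fx (dle0 p) pm).
  split=> [i|i hi]; first by rewrite ffunE; case: (m i) => // mi; apply: geq_minl.
  apply: (boundary_path_no_edge bx pm); move: hi; rewrite !ffunE.
  by case: (m i) => [mi hi|]; [congr Some; lia|rewrite ltnn].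
Qed.

Lemma initial_segments_kid m x : boundary_path (fun=> True) m x ->
  initial_segments m x (kid (kr (x 0 0))).
Proof.
move=> [[_ _ h] _ _]; have m0 : ext_le 0 m by move=> i; rewrite ffunE; case: (m i).
by exists 0; rewrite // {2}h.
Qed.

Lemma fconcat_segments_le a b m x : boundary_path (fun=> True) m x ->
  ks a = kr (x 0 0) -> ks b = kr (x 0 0) ->
  (fconcat b (initial_segments m x) `<=` fconcat a (initial_segments m x))%classic ->
  forall q, ext_le q m -> exists2 t, ext_le t m &
    is_prefix (kcomp b (x 0 q)) (kcomp a (x 0 t)).
Proof.
move=> [fx _ _] ax bx sub q qm.
have bq : ks b = kr (x 0 q) by rewrite (functor_rng fx) //; apply: dle0.
have [_ [[t tm ->] at_] h] : fconcat a (initial_segments m x) (kcomp b (x 0 q)).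
  apply: sub; exists (x 0 q); last exact: is_prefix_refl.
  by split=> //; exists q.
by exists t.
Qed.

(** In direction [i] the segments of $bx$ attain degree $d(b)_i+m_i$, while those of $ax$ never
    exceed $d(a)_i+m_i$. *)
Lemma fconcat_segments_deg a b m x i mi : boundary_path (fun=> True) m x ->
  ks a = kr (x 0 0) -> ks b = kr (x 0 0) ->
  fconcat b (initial_segments m x) = fconcat a (initial_segments m x) ->
  m i = Some mi -> (kd b i <= kd a i)%N.
Proof.
move=> bx ax bx' e hi; have [fx _ _] := bx.
pose q : ndeg k := [ffun j => if j == i then mi else 0%N].
have qm : ext_le q m.
  by move=> j; rewrite ffunE; case: eqVneq => [->|_]; [rewrite hi|case: (m j)].
have sub : (fconcat b (initial_segments m x) `<=` fconcat a (initial_segments m x))%classic.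
  by rewrite e.
have [t tm] := fconcat_segments_le bx ax bx' sub qm.
move=> /is_prefix_deg /(_ i); rewrite !kcomp_deg ?(functor_rng fx (dle0 _)) //.
rewrite !(functor_deg0 fx) // !ffunE eqxx; have := tm i; rewrite hi; lia.
Qed.

(** Translates equality of filters into the equality of paths in Condition (B). The extended degrees
    agree: infinite coordinates absorb $d(a)$ and $d(b)$, finite ones are compared by
    [fconcat_segments_deg]. *)
Lemma fconcat_concat_eq a b m x : boundary_path (fun=> True) m x ->
  ks a = kr (x 0 0) -> ks b = kr (x 0 0) ->
  fconcat a (initial_segments m x) = fconcat b (initial_segments m x) ->
  concat_eq a b m x.
Proof.
move=> bx ax bx' e; have [fx _ _] := bx.
have [y ya] := concat_exists fx ax; have [_ fy hy] := ya.
exists (ext_add (kd a) m), y; split=> //.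
have em : ext_add (kd a) m = ext_add (kd b) m.
  apply/ffunP => i; rewrite !ffunE; case hi: (m i) => [mi|] //=.
  have h1 := fconcat_segments_deg bx ax bx' (esym e) hi.
  have h2 := fconcat_segments_deg bx bx' ax e hi.
  by congr Some; lia.
split=> // q qm.
have sub : (fconcat b (initial_segments m x) `<=` fconcat a (initial_segments m x))%classic.
  by rewrite e.
have [t tm] := fconcat_segments_le bx ax bx' sub qm.
rewrite -hy // => /(functor_prefix fy (ext_le_add _ tm))[_ ->].
by rewrite kcomp_deg ?(functor_deg0 fx) // (functor_rng fx) //; apply: dle0.
Qed.

End BoundaryPaths.

(** * Annihilators in Kumjian-Pask algebras *)

Section KumjianPask.
Variables (k : nat) (L : kgraph k) (R : comNzRingType) (Alg : algType R).
Variables (p : kvert L -> Alg) (s ss : kpath L -> Alg).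
Hypothesis (rf : row_finite L) (lc : locally_convex L).
Hypothesis (fam : KP_family p s ss).
Local Notation V := (kvert L).
Local Notation P := (kpath L).
Local Notation gen := (KPgen p s ss).
Local Open Scope ring_scope.
Implicit Types (a b l : P) (v : V) (n q t : ndeg k) (x y : Alg) (S : seq (R * P)).

Lemma KP_proj_idem v : p v * p v = p v.
Proof. by case: fam => -[h _] _ _ _; apply: h. Qed.

Lemma KP_proj_orth v w : v <> w -> p v * p w = 0.
Proof. by case: fam => -[_ h] _ _ _; apply: h. Qed.

Lemma KP_s_comp a b : ks a = kr b -> s a * s b = s (kcomp a b).
Proof. by case: fam => _ [h _] _ _ /h[]. Qed.

Lemma KP_ss_comp a b : ks a = kr b -> ss b * ss a = ss (kcomp a b).
Proof. by case: fam => _ [h _] _ _ /h[]. Qed.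

Lemma KP_proj_s a : p (kr a) * s a = s a.
Proof. by case: fam => _ [_ h] _ _; case: (h a). Qed.

Lemma KP_s_proj a : s a * p (ks a) = s a.
Proof. by case: fam => _ [_ h] _ _; case: (h a). Qed.

Lemma KP_proj_ss a : p (ks a) * ss a = ss a.
Proof. by case: fam => _ [_ h] _ _; case: (h a). Qed.

Lemma KP_ss_proj a : ss a * p (kr a) = ss a.
Proof. by case: fam => _ [_ h] _ _; case: (h a). Qed.

Lemma KP_proj_s0 v a : v <> kr a -> p v * s a = 0.
Proof. by move=> /KP_proj_orth h; rewrite -KP_proj_s mulrA h mul0r. Qed.

Lemma KP_s_comp0 a b : ks a <> kr b -> s a * s b = 0.
Proof. by move=> h; rewrite -KP_s_proj -mulrA KP_proj_s0 ?mulr0. Qed.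

Lemma KP_ss_comp0 a b : kr a <> kr b -> ss a * s b = 0.
Proof. by move=> h; rewrite -KP_ss_proj -mulrA KP_proj_s0 ?mulr0. Qed.

Lemma KP_ss_s n a b : n <> dzero k -> le_set (fun=> True) n a ->
  le_set (fun=> True) n b -> ss a * s b = if a == b then p (ks a) else 0.
Proof. by case: fam => _ _ h _; apply: h. Qed.

Lemma le_set_enum v n : exists2 S : seq P, uniq S &
  forall a, a \in S <-> le_set (fun=> True) n a /\ kr a = v.
Proof.
pose N := (\max_i n i)%N.
pose D : seq (ndeg k) := [seq [ffun i => nat_of_ord (f i)] | f : {ffun 'I_k -> 'I_N.+1}].
have hD q : dle q n -> q \in D.
  move=> h; apply/mapP; exists [ffun i => inord (q i)]; first by rewrite mem_enum inE.
  apply/ffunP => i; rewrite !ffunE inordK // ltnS.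
  by apply: leq_trans (h i) _; apply: leq_bigmax.
have [F hF] := choice (fun q => rf v q).
exists (undup [seq a <- flatten [seq F q | q <- D] |
    `[< le_set (fun=> True) n a /\ kr a = v >]]); first exact: undup_uniq.
move=> a; rewrite mem_undup mem_filter; split=> [/andP[/asboolP]//|h].
rewrite asboolT //=; apply/flatten_mapP; exists (kd a); last by apply: hF => //; case: h.
by apply: hD; case: h => /le_setE[].
Qed.

Lemma KP_proj_expand v n : n <> dzero k -> exists2 S : seq P,
  uniq S /\ (forall a, a \in S <-> le_set (fun=> True) n a /\ kr a = v) &
  p v = \sum_(a <- S) s a * ss a.
Proof.
move=> n0; have [S uS hS] := le_set_enum v n; exists S => //.
by case: fam => _ _ _ h; apply: (h v n).
Qed.

(** * Linear combinations of shifts with a common source *)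

Definition shift_sum S : Alg := \sum_(z <- S) z.1 *: s z.2.

Definition sourced v S := forall z, z \in S -> ks z.2 = v.

(** A list may mention a path several times, so independence concerns these collected
    coefficients. *)
Definition coef S a : R := \sum_(z <- S | z.2 == a) z.1.

Lemma shift_sum_coef S : shift_sum S = \sum_(a <- undup (map snd S)) coef S a *: s a.
Proof.
rewrite /shift_sum; under [RHS]eq_bigr do rewrite /coef scaler_suml.
rewrite (exchange_big_dep xpredT) //=; apply: eq_big_seq => z zS.
rewrite big_mkcond (bigD1_seq z.2) ?undup_uniq ?mem_undup ?map_f //= eqxx.
by rewrite big1 ?addr0 // => a az; rewrite eq_sym (negPf az).
Qed.

Lemma shift_sum_eq0 S : (forall a, a \in map snd S -> coef S a = 0) -> shift_sum S = 0.
Proof.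
move=> h; rewrite shift_sum_coef big1_seq // => a /andP[_ ].
by rewrite mem_undup => /h ->; rewrite scale0r.
Qed.

Lemma KPgen0 : V -> gen 0.
Proof. by move=> v; rewrite -(scale0r (p v)); apply/KPgen_scale/KPgen_p. Qed.

Lemma KPgen_shift_sum v S : gen (shift_sum S).
Proof.
rewrite /shift_sum; elim: S => [|z S IH]; first by rewrite big_nil; apply: KPgen0.
by rewrite big_cons; apply: KPgen_add IH; apply/KPgen_scale/KPgen_s.
Qed.

(* An aperiodic boundary path at the common source separates the shifts. *)
Lemma shift_independent v S : KP_universal p s ss -> condB_at (fun=> True) v ->
  sourced v S -> shift_sum S = 0 -> forall a, ks a = v -> coef S a = 0.
Proof.
move=> univ [m [x [bx xv aper]]] src S0 a av.
have [phi [phiD phiZ _ phis]] := univ _ _ _ _ (path_representation R lc).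
have phi0 : phi 0 = 0.
  by rewrite -(scale0r (p v)) phiZ ?scale0r //; apply: KPgen_p.
have phiS (S' : seq (R * P)) : phi (shift_sum S') =
    \sum_(z <- S') z.1 *: path_shift (L := L) R z.2.
  rewrite /shift_sum; elim: S' => [|z S' IH]; first by rewrite !big_nil.
  rewrite !big_cons -IH; have [-> _] := phiD _ _
    (KPgen_scale z.1 (KPgen_s p s ss z.2)) (KPgen_shift_sum v S').
  by rewrite phiZ ?(phis z.2).1 //; apply: KPgen_s.
pose U := initial_segments m x.
have bU : boundary_filter U by apply: boundary_filter_segments.
have Uv : U (kid v) by rewrite -xv; apply: initial_segments_kid.
(* Evaluated at $aU$, the shift by $z$ turns the indicator of $U$ into 1 exactly when $zU=aU$, which
   aperiodicity allows only for $z=a$. The value of the whole sum is therefore the coefficient of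
   [a]. *)
pose f (Y : set P) : R := if `[< Y = U >] then 1 else 0.
have := phiS S; rewrite S0 phi0 => /(congr1 (fun A => op_fun A f (fconcat a U))).
rewrite op_sumE /= => E; rewrite /coef big_mkcond /= [RHS]E.
apply: eq_big_seq => z zS /=; rewrite /f.
have bv := src z zS.
have baU : boundary_filter (fconcat a U) by apply: boundary_filter_fconcat; rewrite ?av.
case: eqP => [->|za].
  rewrite asboolT; last by split=> //; apply: fconcat_mem; rewrite av.
  by rewrite fquot_fconcat ?av // asboolT // mulr1.
case: asboolP => [[_ zU]|_]; last by rewrite mulr0.
case: asboolP => [e|_]; last by rewrite mulr0.
have /(fconcat_concat_eq bx) : fconcat z.2 U = fconcat a U.
  by rewrite -{1}e fconcat_fquot.
by rewrite xv => /(_ bv av) ceq; case: (aper z.2 a).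
Qed.

Lemma shift_sum_mulr S v b : sourced v S -> kr b = v ->
  shift_sum S * s b = shift_sum [seq (z.1, kcomp z.2 b) | z <- S].
Proof.
move=> src bv; rewrite /shift_sum mulr_suml big_map; apply: eq_big_seq => z zS /=.
by rewrite -scalerAl KP_s_comp // src.
Qed.

(** By right cancellation, appending [b] keeps distinct paths distinct, so the coefficients are
    unchanged; independence at the source of [b] makes them vanish. *)
Lemma shift_sum_mulr_inj S v b : KP_universal p s ss ->
  condB_at (fun=> True) (ks b) -> sourced v S -> kr b = v ->
  shift_sum S * s b = 0 -> shift_sum S = 0.
Proof.
move=> univ cB src bv; rewrite (shift_sum_mulr src bv) => E.
have src' : sourced (ks b) [seq (z.1, kcomp z.2 b) | z <- S].
  by move=> _ /mapP[z zS ->] /=; rewrite kcomp_src // src.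
apply: shift_sum_eq0 => a /mapP[z zS ->].
have zb : ks z.2 = kr b by rewrite src.
rewrite -(shift_independent univ cB src' E (kcomp_src zb)).
rewrite /coef big_map /= big_seq_cond [RHS]big_seq_cond; apply: eq_bigl => w.
case wS: (w \in S) => //=; apply/eqP/eqP => [->//|]; apply: kcomp_injr => //.
by rewrite src.
Qed.

(** * Elements of the algebra acting on deep shifts *)

Definition deep_span n v x :=
  exists2 S, sourced v S /\ (forall z, z \in S -> deep n z.2) & x = shift_sum S.

Lemma deep_span0 n v : deep_span n v 0.
Proof. by exists [::]; rewrite // /shift_sum big_nil. Qed.

Lemma deep_spanD n v x y : deep_span n v x -> deep_span n v y -> deep_span n v (x + y).
Proof.
move=> [S [h1 h2] ->] [S' [h1' h2'] ->]; exists (S ++ S').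
  by split=> z; rewrite mem_cat => /orP[]; auto.
by rewrite /shift_sum big_cat.
Qed.

Lemma deep_spanZ n v c x : deep_span n v x -> deep_span n v (c *: x).
Proof.
move=> [S [h1 h2] ->]; exists [seq (c * z.1, z.2) | z <- S].
  by split=> _ /mapP[z zS ->] /=; auto.
by rewrite /shift_sum big_map scaler_sumr; apply: eq_bigr => z _; rewrite scalerA.
Qed.

Lemma deep_span_sum (I : eqType) (r : seq I) (F : I -> Alg) n v :
  (forall i, i \in r -> deep_span n v (F i)) -> deep_span n v (\sum_(i <- r) F i).
Proof.
elim: r => [|i r IH] h; first by rewrite big_nil; apply: deep_span0.
rewrite big_cons; apply: deep_spanD; first by apply: h; rewrite mem_head.
by apply: IH => j jr; apply: h; rewrite in_cons jr orbT.
Qed.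

Lemma deep_span_s n a : deep n a -> deep_span n (ks a) (s a).
Proof.
move=> da; exists [:: (1, a)]; last by rewrite /shift_sum big_seq1 scale1r.
by split=> z; rewrite inE => /eqP ->.
Qed.

(** Any prescribed depth [n] of the outcome is demanded so that the property passes to products:
    $ys_b$ must consist of shifts deep enough for $x$ to act on. *)
Definition eventually_shift x := forall n, exists N, forall b,
  deep N b -> deep_span n (ks b) (x * s b).

(** Expand $p_{s(a)}$ over paths $c$ in $\Lambda^{\le M}$, with $M$ chosen so that $ac$ and $b$ lie
    in the same $\Lambda^{\le d(a)+M}$. Then (KP3) leaves only $s_c$ with $b=ac$, or zero. *)
Lemma ss_s_span (kpos : (0 < k)%N) n a b :
  deep (dadd (dadd (kd a) n) [ffun=> 1%N]) b -> deep_span n (ks b) (ss a * s b).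
Proof.
set N := dadd _ _ => dN.
have [ab|/eqP/KP_ss_comp0 ->] := eqVneq (kr a) (kr b); last exact: deep_span0.
(* The summand 1 in the depth bound makes [M] nonzero, as (KP4) requires. *)
pose M := dsub (dmax (kd b) N) (kd a).
have eM : dadd (kd a) M = dmax (kd b) N.
  by apply/ndegP => i; rewrite !ffunE; lia.
have nz (q : ndeg k) : (0 < q (Ordinal kpos))%N -> q <> dzero k.
  by move=> h e; rewrite e ffunE in h.
have M0 : M <> dzero k by apply: nz; rewrite !ffunE; lia.
have N0 : dmax (kd b) N <> dzero k by apply: nz; rewrite !ffunE; lia.
have bN : le_set (fun=> True) (dmax (kd b) N) b.
  apply/le_setE; split; first exact: dle_maxl.
  by move=> i; rewrite ffunE => hi; apply: dN; lia.
have [S [uS hS] eS] := KP_proj_expand (ks a) M0.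
rewrite -KP_proj_ss eS -mulrA mulr_suml; apply: deep_span_sum => c cS.
have [cM ca] : le_set (fun=> True) M c /\ kr c = ks a by apply/hS.
have acN : le_set (fun=> True) (dmax (kd b) N) (kcomp a c).
  by rewrite -eM; apply/le_set_comp.
rewrite -mulrA [ss c * _]mulrA KP_ss_comp // (KP_ss_s N0 acN bN).
case: eqP => [e|_]; last by rewrite mulr0; apply: deep_span0.
have -> : ks b = ks c by rewrite -e kcomp_src.
rewrite kcomp_src // KP_s_proj; apply: deep_span_s => i hi.
have -> : ks c = ks b by rewrite -e kcomp_src.
by apply: dN; rewrite -e kcomp_deg // !ffunE; lia.
Qed.

Lemma eventually_shift_gen (kpos : (0 < k)%N) x : gen x -> eventually_shift x.
Proof.
elim=> {x} [v|a|a|x y _ hx _ hy|c x _ hx|x y _ hx _ hy] n.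
- exists n => b db; have [->|/eqP h] := eqVneq v (kr b).
    by rewrite KP_proj_s; apply: deep_span_s.
  by rewrite KP_proj_s0 //; apply: deep_span0.
- exists n => b db; have [h|/eqP h] := eqVneq (ks a) (kr b); last first.
    by rewrite KP_s_comp0 //; apply: deep_span0.
  rewrite KP_s_comp // -(kcomp_src h); apply: deep_span_s => i.
  by rewrite kcomp_deg // kcomp_src // ffunE => hi; apply: db; lia.
- by exists (dadd (dadd (kd a) n) [ffun=> 1%N]) => b; apply: ss_s_span.
- have [N1 h1] := hx n; have [N2 h2] := hy n; exists (dmax N1 N2) => b db.
  rewrite mulrDl; apply: deep_spanD;
    [apply: h1|apply: h2]; apply: deep_le db; [exact: dle_maxl|exact: dle_maxr].
- have [N h] := hx n; exists N => b /h db; rewrite -scalerAl; exact: deep_spanZ.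
- have [N1 h1] := hx n; have [N2 h2] := hy N1; exists N2 => b /h2[S [src dS] e].
  rewrite -mulrA e /shift_sum mulr_sumr; apply: deep_span_sum => z zS.
  by rewrite -scalerAr -(src z zS); apply/deep_spanZ/h1/dS.
Qed.

(** The claim covers all larger lists so that two summands can share one list. *)
Lemma local_unit x : gen x -> exists2 F : seq V, uniq F &
  forall F', uniq F' -> {subset F <= F'} -> \sum_(v <- F') x * p v = x.
Proof.
have unit1 y v : y * p v = y -> forall F', uniq F' -> {subset [:: v] <= F'} ->
    \sum_(w <- F') y * p w = y.
  move=> e F' uF sF; rewrite (bigD1_seq v) //=; last by apply: sF; rewrite mem_head.
  rewrite e big1 ?addr0 // => w /eqP wv; rewrite -e -mulrA KP_proj_orth ?mulr0 //.
  exact: nesym.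
elim=> {x} [v|a|a|x y _ [F uF hF] _ [G uG hG]|c x _ [F uF hF]|x y _ _ _ [G uG hG]].
- by exists [:: v] => //; apply: unit1; apply: KP_proj_idem.
- by exists [:: ks a] => //; apply: unit1; apply: KP_s_proj.
- by exists [:: kr a] => //; apply: unit1; apply: KP_ss_proj.
- exists (undup (F ++ G)); first exact: undup_uniq.
  move=> F' uF' sF; under eq_bigr do rewrite mulrDl.
  rewrite big_split /= hF ?hG // => w h; apply: sF; rewrite mem_undup mem_cat h ?orbT //.
- exists F => // F' uF' sF; under eq_bigr do rewrite -scalerAl.
  by rewrite -scaler_sumr hF.
- exists G => // F' uF' sF; under eq_bigr do rewrite -mulrA.
  by rewrite -mulr_sumr hG.
Qed.

(** (KP4) expands $p_v$ over $v\Lambda^{\le n+1}$, whose members are all deep for [n]; the added 1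
    makes the degree nonzero. *)
Lemma gen_mulr_eq0 (kpos : (0 < k)%N) n v y :
  (forall b, deep n b -> kr b = v -> y * s b = 0) -> y * p v = 0.
Proof.
move=> h; have n0 : dadd n [ffun=> 1%N] <> dzero k.
  by move=> /ndegP /(_ (Ordinal kpos)); rewrite !ffunE; lia.
have [S [_ hS] ->] := KP_proj_expand v n0.
rewrite mulr_sumr big1_seq // => b /andP[_ /hS[/le_setE[_ db] bv]].
by rewrite mulrA h ?mul0r //; apply: deep_le db; apply: dle_add.
Qed.

(** * Ideals and their double annihilators *)

Section Ideal.
Variable J : Alg -> Prop.
Hypotheses (kpos : (0 < k)%N) (univ : KP_universal p s ss)
  (cB : condB (L := L) (fun=> True)) (idJ : KP_ideal p s ss J).
Local Notation H := (HJ p J).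

(** $p_{s(a)}=s_{a^*}p_{r(a)}s_a$. Degree zero is treated apart because (KP3) is stated for nonzero
    degrees. *)
Lemma ideal_hereditary a : H (kr a) -> H (ks a).
Proof.
case: idJ => _ _ _ _ hM; rewrite /HJ => Ja.
have [/kd0_id e|/eqP d0] := eqVneq (kd a) (dzero k).
  by move: Ja; rewrite {2}e kid_src.
have na : le_set (fun=> True) (kd a) a by apply/le_setE; split=> // i; rewrite ltnn.
have := KP_ss_s d0 na na; rewrite eqxx => <-.
have [h _] := hM _ _ (KPgen_ss p s ss a) Ja; rewrite KP_ss_proj in h.
by have [_ h'] := hM _ _ (KPgen_s p s ss a) h.
Qed.

Lemma ideal_shift a : H (ks a) -> J (s a).
Proof.
case: idJ => _ _ _ _ hM h; rewrite -KP_s_proj.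
by have [] := hM _ _ (KPgen_s p s ss a) h.
Qed.

(* Right multiplication by s c puts s b into J, where x kills it, and is injective on
   combinations of shifts with source s(b). *)
Lemma perp_shift_eq0 x y n b c : perp p s ss J x -> deep_span n (ks b) (y * x * s b) ->
  kr c = ks b -> H (ks c) -> y * x * s b = 0.
Proof.
move=> [_ px] [S [src _] e] cb Hc.
rewrite e; apply: (shift_sum_mulr_inj (v := ks b) (b := c)) => //; first exact: cB.
have Jbc : J (s (kcomp b c)) by apply: ideal_shift; rewrite kcomp_src.
by rewrite -e -mulrA KP_s_comp // -mulrA; have [-> _] := px _ Jbc; rewrite mulr0.
Qed.

Lemma perp_perp_proj w :
  (forall l, kr l = w -> exists2 c, kr c = ks l & H (ks c)) ->
  perp p s ss (perp p s ss J) (p w).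
Proof.
move=> dense; split=> [|x px]; first exact: KPgen_p.
have gx : gen x by case: px.
have [N hN] := eventually_shift_gen kpos gx (dzero k).
split; last first.
  apply: (gen_mulr_eq0 kpos (n := N)) => // b db bw; have [c cb Hc] := dense b bw.
  rewrite -[x]mul1r; apply: perp_shift_eq0 cb Hc => //; rewrite mul1r; exact: hN.
(* On this side [w] does not restrict the paths $b$, so local units reduce $p_wx$ to finitely many
   products $p_wxp_v$. *)
have [F uF /(_ F uF (fun _ => id)) <-] := local_unit gx.
rewrite mulr_sumr big1_seq // => v _; rewrite mulrA.
apply: (gen_mulr_eq0 kpos (n := N)) => // b db _.
have [S [src dS] e] := hN b db.
have e' : p w * x * s b = shift_sum [seq z <- S | kr z.2 == w].
  rewrite -mulrA e /shift_sum mulr_sumr big_filter [RHS]big_mkcond /=.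
  apply: eq_bigr => z _; rewrite -scalerAr; case: eqP => [<-|h].
    by rewrite KP_proj_s.
  by rewrite KP_proj_s0 ?scaler0 //; apply: nesym.
(* A surviving term $z$ has range [w] and source $s(b)$, so the hypothesis on paths from [w],
   applied to $z$, continues $s(b)$ into [H]. With no such term the sum is empty. *)
case: (boolP (has (fun z => kr z.2 == w) S)) => [/hasP[z zS /eqP zw]|]; last first.
  by rewrite e' has_filter negbK => /eqP->; rewrite /shift_sum big_nil.
have [c cz Hc] := dense _ zw.
apply: (perp_shift_eq0 px (n := dzero k) (c := c)) => //; last by rewrite cz src.
exists [seq z <- S | kr z.2 == w] => //.
by split=> u; rewrite mem_filter => /andP[_ uS]; [apply: src|apply: dS].
Qed.

Lemma regular_escape w : regular_ideal p s ss J -> ~ H w ->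
  exists2 l, kr l = w & forall c, kr c = ks l -> ~ H (ks c).
Proof.
move=> reg Hw; apply: contrapT => none; apply/Hw/reg/perp_perp_proj => l lw.
apply: contrapT => no; apply: none; exists l => // c cl Hc; apply: no.
by exists c.
Qed.

End Ideal.
End KumjianPask.

(** * Prolonging an aperiodic boundary path outside $H$ *)

Lemma condB_at_escape (k : nat) (L : kgraph k) (H : kvert L -> Prop) l :
  locally_convex L -> condB (L := L) (fun=> True) ->
  (forall a, H (kr a) -> H (ks a)) ->
  (forall c, kr c = ks l -> ~ H (ks c)) ->
  condB_at (fun v => ~ H v) (kr l).
Proof.
move=> lc cB her esc; have [m [x [bx xv aper]]] := cB (ks l) I.
have [fx _ _] := bx.
have lx q : ext_le q m -> ks l = kr (x (dzero k) q).
  by move=> qm; rewrite (functor_rng fx) //; apply: dle0.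
have m0 : ext_le (dzero k) m by move=> i; rewrite ffunE; case: (m i).
have [y ya] := concat_exists fx (lx _ m0); have [_ fy hy] := ya.
set m' := ext_add _ m in ya fy.
have dm : ext_le (kd l) m'.
  by move=> i; rewrite ffunE; case: (m i) => //= mi; rewrite leq_addr.
have yx q : ext_le q m -> kr (y (dadd (kd l) q) (dadd (kd l) q)) = kr (x q q).
  move=> qm; rewrite -(functor_src fy (dle0 _)); last exact: ext_le_add.
  by rewrite hy // (kcomp_src (lx _ qm)) (functor_src fx) //; apply: dle0.
(* From $y(q)$ one runs along $y=lx$ to $y(q\vee d(l))$, which is the vertex $x(t)$ since beyond [l]
   the path is [x]. *)
have tail q : ext_le q m' -> exists2 t, ext_le t m /\ dmax q (kd l) = dadd (kd l) t &
    [/\ dle q (dadd (kd l) t), ext_le (dadd (kd l) t) m' & kr (x t t) =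
      ks (y q (dadd (kd l) t))].
  move=> qm; have M := ext_le_max qm dm.
  have e : dadd (kd l) (dsub (dmax q (kd l)) (kd l)) = dmax q (kd l).
    by apply: dsubK; apply: dle_maxr.
  have tm := ext_le_subl M.
  exists (dsub (dmax q (kd l)) (kd l)) => //; rewrite -yx // e; split=> //.
    exact: dle_maxl.
  by rewrite (functor_src fy) //; apply: dle_maxl.
(* $x(t)$ is reached from $s(l)$ and so avoids [H]; as [H] is hereditary, $y(q)$ avoids it too. *)
have nH q : ext_le q m' -> ~ H (kr (y q q)).
  move=> qm; have [t [tm _] [h1 h2 h3]] := tail q qm.
  rewrite -(functor_rng fy h1 h2) => /her; rewrite -h3 -(functor_src fx (dle0 t) tm).
  by apply: esc; rewrite -(lx _ tm).
have y0 : kr (y (dzero k) (dzero k)) = kr l.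
  have := congr1 (@kr _ L) (hy _ m0); rewrite (kcomp_rng (lx _ m0)) => <-.
  by rewrite (functor_rng fy (dle0 _)) //; apply: ext_le_add.
(* If $y$ has ended in direction [i] at [q], then the segment from $y(q)$ to $x(t)$ has degree zero
   in [i] and $x$ has ended at [t]. Local convexity would carry an edge from $y(q)$ to $x(t)$, where
   there is none. *)
have no_edge q i : ext_le q m' -> m' i = Some (q i) -> ~ has_edge (kr (y q q)) i.
  move=> qm mi he; have [t [tm et] [h1 h2 h3]] := tail q qm.
  have hm : m i = Some (t i).
    have := congr1 (fun f : ndeg k => f i) et; move: mi (qm i); rewrite !ffunE.
    by case: (m i) => //= mi [<-] _ h; congr Some; lia.
  apply: (boundary_path_no_edge bx tm hm); rewrite h3.
  apply: has_edge_along => //; last by rewrite (functor_rng fy).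
  rewrite (functor_deg fy) // -et !ffunE.
  by move: mi; rewrite ffunE hm /= => -[]; lia.
exists m', y; split=> //.
  split=> // [q t qt tm|q i qm /(omega_le_onlyP i qm) mi e].
    split; first by rewrite (functor_rng fy) //; apply/nH/ext_le_trans/tm.
    by rewrite (functor_src fy) //; apply: nH.
  split=> [[[_ he _] er]|->].
    have [e0|ei] := posnP (kd e i); last first.
      by case: (no_edge q i qm mi); rewrite -er; apply: has_edge_prefix.
    rewrite -er; apply: kd0_id; apply/ndegP => j; rewrite ffunE.
    by have := he j; rewrite ffunE; case: eqVneq => [->|_]; lia.
  rewrite kid_rng; split=> //; split.
  - by split; rewrite ?kid_rng ?kid_src; apply: nH.
  - by rewrite kid_deg; apply: dle0.
  - move=> j; rewrite kid_src !kid_deg !ffunE; case: eqVneq => // -> _ [f [_ er ed]].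
    by apply: (no_edge q i qm mi); exists f.
move=> a b _ _ al bl ab [m2 [z [za zb]]].
(* Since $cy=(cl)x$, a coincidence $ay=by$ gives $(al)x=(bl)x$, and $al\ne bl$ by right
   cancellation. *)
have comp c : ks c = kr l -> concat_is c m' y m2 z -> concat_is (kcomp c l) m x m2 z.
  move=> cl [em fz hz]; split=> // [|q qm].
    rewrite em; apply/ffunP => i; rewrite !ffunE kcomp_deg // ffunE.
    by case: (m i) => //= mi; rewrite addnA.
  rewrite (kcomp_assoc cl (lx _ qm)) -hy // -hz; last exact: ext_le_add.
  by congr (z _ _); rewrite kcomp_deg //; degree_ext.
apply: (aper (kcomp a l) (kcomp b l)) => //; rewrite ?kcomp_src //.
  by move=> /(kcomp_injr al bl).
by exists m2, z; split; apply: comp.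
Qed.

Theorem mainTheorem8 (k : nat) (L : kgraph k) (R : comRingType) (Alg : algType R)
    (p : kvert L -> Alg) (s ss : kpath L -> Alg) (J : Alg -> Prop) :
  (0 < k)%N ->
  row_finite L -> locally_convex L -> condB (L := L) (fun _ => True) ->
  KP_family p s ss -> KP_universal p s ss ->
  KP_ideal p s ss J -> regular_ideal p s ss J -> basic_ideal p J ->
  graded_ideal s ss J ->
  condB (L := L) (fun v => ~ HJ p J v).
Proof.
move=> kpos rf lc cB fam univ idJ reg _ _ w Hw.
have [l <- esc] := regular_escape rf lc fam kpos univ cB idJ reg Hw.
exact: condB_at_escape lc cB (ideal_hereditary fam idJ) esc.
Qed.
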